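(* There do not exist integers $a, b, x$ and primes $p, q$ such that \[ x^3 - 1 = p^2 a^3 \qquad\text{and}\qquad x^3 + 1 = q^2 b^3 . \] Equivalently, there are no three consecutive powerful numbers of the form $x^3-1 = p^2a^3$, $x^3$, $x^3+1 = q^2 b^3$ with $p,q$ prime and $a,b,x$ integers.
   Context: A positive integer is called powerful if every prime factor of it appears with exponent at least two. *)

(* Defs.v *)
From mathcomp Require Import all_boot all_order all_algebra.

(* Main.v *)
(** Since [x^3 - 1 = (x - 1) (x^2 + x + 1)] and the gcd of the two factors
    divides 3, one factor is a cube, up to a power of 3; the same holds for
    [x^3 + 1].  When 3 does not divide [x^2 - 1], each combination of these
    cubes is excluded by its size.  When [x = 3 t + 1], either
    [3 t^2 + 3 t + 1 = (t + 1)^3 - t^3] is a cube, or [x - 1 = 9 u^3], which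
    together with [x^2 - x + 1 = w^3] yields coprime [a, b] with
    [a b (a - b) = 3 u^3].  The equations [a b (a - b) = k c^3], for [k = 1]
    (Fermat) and [k = 3] (Legendre), are solved by infinite descent in the
    Eisenstein integers. *)
From Stdlib Require Import ZArith Znumtheory Lia.

Section ConsecutivePowerful.
Local Open Scope Z_scope.

(** * Eisenstein integers: norm, Euclidean division, cubes up to units *)

Record eis := Eis { re : Z; om : Z }.

Definition ezero := Eis 0 0.
Definition eone := Eis 1 0.
Definition eadd u v := Eis (re u + re v) (om u + om v).
Definition eopp u := Eis (- re u) (- om u).
Definition esub u v := eadd u (eopp v).
(** [Eis x y] stands for [x + y omega], with omega a primitive cube root of unity. Products are
    reduced by [omega^2 = - 1 - omega], and conjugation exchanges omega and [omega^2]. *)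
Definition emul u v :=
  Eis (re u * re v - om u * om v) (re u * om v + om u * re v - om u * om v).
Definition econj u := Eis (re u - om u) (- om u).
Definition enorm u := re u * re u - re u * om u + om u * om u.

Lemma eis_ext u v : re u = re v -> om u = om v -> u = v.
Proof. destruct u, v; cbn [re om]; congruence. Qed.

Lemma eis_ring : ring_theory ezero eone eadd emul esub eopp eq.
Proof.
  split; intros; apply eis_ext;
    unfold esub, eadd, emul, eopp, ezero, eone; cbn [re om]; ring.
Qed.
Add Ring eis_ring : eis_ring.

Lemma enormM u v : enorm (emul u v) = enorm u * enorm v.
Proof. unfold enorm, emul; cbn [re om]; ring. Qed.

Lemma enorm_ge0 u : 0 <= enorm u.
Proof. unfold enorm; nia. Qed.

Lemma enorm_eq0 u : enorm u = 0 -> u = ezero.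
Proof.
  unfold enorm; intro H; apply eis_ext; simpl; nia.
Qed.

(** Since [4 (x^2 - x y + y^2) = (2 x - y)^2 + 3 y^2], norm 1 forces [|y| <= 1]. *)
Lemma enorm_eq1 u : enorm u = 1 ->
  (om u = 0 /\ (re u = 1 \/ re u = -1)) \/ (om u = 1 \/ om u = -1).
Proof.
  destruct u as [x y]; unfold enorm; cbn [re om]; intro H.
  assert (Hy : -1 <= y <= 1) by nia.
  assert (Hy' : y = 0 \/ y = 1 \/ y = -1) by lia.
  destruct Hy' as [-> | [-> | ->]]; [left; split; nia | auto..].
Qed.

Lemma emul_conj u : emul u (econj u) = Eis (enorm u) 0.
Proof. apply eis_ext; unfold emul, econj, enorm; cbn [re om]; ring. Qed.

Lemma nearest_quotient x n : 0 < n -> exists q r, x = n * q + r /\ - n <= 2 * r <= n.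
Proof.
  intro Hn; exists ((2 * x + n) / (2 * n)), (x - n * ((2 * x + n) / (2 * n))).
  pose proof (Z.div_mod (2 * x + n) (2 * n)).
  pose proof (Z.mod_pos_bound (2 * x + n) (2 * n)).
  split; [ring | lia].
Qed.

(** The quotient [u / v = u * econj v / enorm v] is rounded coordinatewise. The error has
    coordinates of absolute value at most 1/2, hence norm at most 3/4. *)
Lemma eis_division u v : v <> ezero ->
  exists q r, u = eadd (emul q v) r /\ enorm r < enorm v.
Proof.
  intro Hv.
  assert (Hn : 0 < enorm v).
  { destruct (Z.eq_dec (enorm v) 0) as [H|H].
    - apply enorm_eq0 in H; contradiction.
    - pose proof (enorm_ge0 v); lia. }
  set (n := enorm v) in *.
  destruct (nearest_quotient (re (emul u (econj v))) n Hn) as (q1 & r1 & E1 & B1).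
  destruct (nearest_quotient (om (emul u (econj v))) n Hn) as (q2 & r2 & E2 & B2).
  set (q := Eis q1 q2); set (r := esub u (emul q v)).
  exists q, r; split.
  - unfold r; ring.
  - assert (Hr : emul r (econj v) = Eis r1 r2).
    { assert (E : emul r (econj v) = esub (emul u (econj v)) (emul q (Eis n 0))).
      { unfold n; rewrite <- emul_conj; unfold r; ring. }
      rewrite E; apply eis_ext; cbn [esub eadd eopp re om];
        [rewrite E1 | rewrite E2]; unfold q, emul; cbn [re om]; ring. }
    apply (f_equal enorm) in Hr; rewrite enormM in Hr.
    assert (Hc : enorm (econj v) = n) by (unfold n, enorm, econj; cbn [re om]; ring).
    rewrite Hc in Hr; unfold enorm in Hr at 2; cbn [re om] in Hr.
    assert (4 * (r1 * r1 - r1 * r2 + r2 * r2) <= 3 * (n * n)) by nia.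
    pose proof (enorm_ge0 r); nia.
Qed.

Lemma eis_bezout u v : exists d a b u' v',
  d = eadd (emul a u) (emul b v) /\ u = emul d u' /\ v = emul d v'.
Proof.
  remember (Z.to_nat (enorm v)) as n eqn:Hn.
  revert u v Hn; induction n as [n IH] using (well_founded_induction Wf_nat.lt_wf).
  intros u v ->.
  destruct (Z.eq_dec (enorm v) 0) as [H|H].
  - apply enorm_eq0 in H; subst v.
    exists u, eone, ezero, eone, ezero; repeat split; ring.
  - assert (Hv : v <> ezero) by (intros ->; apply H; reflexivity).
    destruct (eis_division u v Hv) as (q & r & E & Hr).
    pose proof (enorm_ge0 r).
    destruct (IH (Z.to_nat (enorm r)) ltac:(lia) v r eq_refl)
      as (d & a & b & v' & r' & Ed & Ev & Er).
    exists d, b, (esub a (emul b q)), (eadd (emul q v') r'), v'.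
    repeat split; [| | exact Ev].
    + rewrite Ed, E; ring.
    + rewrite E, Er, Ev at 1; ring.
Qed.

Definition ecube u := emul u (emul u u).

(* For the ideal [(u, v)] one has [(u, v)^3 = u (u^2, u v, v^2, conj u) = (u)],
   so its generator cubed is [u] up to a unit. *)
Lemma eis_unit_mul_cube_of_norm_cube u v a b :
  u <> ezero -> emul u (econj u) = ecube v ->
  eadd (emul a u) (emul b (econj u)) = eone ->
  exists e d, enorm e = 1 /\ u = emul e (ecube d).
Proof.
  intros Hu Huv Hab.
  destruct (eis_bezout u v) as (d & r & s & u' & v' & Ed & Eu & Ev).
  assert (H1 : exists e, u = emul (ecube d) e).
  (* Expand [u = u (a u + b conj u)^2]: every term contains [u^3] or [u conj u = v^3], and [d]
     divides both [u] and [v]. *)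
  { exists (eadd (emul (emul a a) (ecube u'))
     (emul (eadd (emul (emul b b) (econj u)) (emul (eadd a a) (emul b u))) (ecube v'))).
    transitivity (emul u (emul (eadd (emul a u) (emul b (econj u)))
                               (eadd (emul a u) (emul b (econj u))))).
    - rewrite Hab; ring.
    - transitivity (eadd (emul (emul a a) (ecube u))
        (emul (eadd (emul (emul b b) (econj u)) (emul (eadd a a) (emul b u)))
              (emul u (econj u)))).
      + unfold ecube; ring.
      + rewrite Huv, Ev; rewrite Eu at 1; unfold ecube; ring. }
  assert (H2 : exists e, ecube d = emul u e).
  (* In [d^3 = (r u + s v)^3] the only term without a visible factor [u] is
     [s^3 v^3 = s^3 u conj u]. *)
  { exists (eadd (emul (ecube s) (econj u))
      (eadd (emul (ecube r) (emul u u))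
        (eadd (emul (emul (emul r r) (emul u s)) (eadd v (eadd v v)))
              (emul (emul r (emul s s)) (emul v (eadd v (eadd v v))))))).
    transitivity (eadd (emul (ecube s) (emul u (econj u)))
      (esub (ecube d) (emul (ecube s) (ecube v)))); [rewrite Huv; ring|].
    rewrite Ed; unfold ecube; ring. }
  destruct H1 as [e He], H2 as [f Hf].
  exists e, d; split; [| rewrite He at 1; ring].
  assert (Hn : enorm u = enorm u * enorm (emul e f)).
  { rewrite <- enormM; f_equal. rewrite He at 1; rewrite Hf; ring. }
  rewrite enormM in Hn.
  assert (Hu0 : enorm u <> 0) by (intro H; apply enorm_eq0 in H; contradiction).
  assert (H0 : enorm e * enorm f = 1) by (apply (Z.mul_reg_l _ _ (enorm u)); lia).
  pose proof (enorm_ge0 e); apply Z.mul_eq_1 in H0; lia.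
Qed.

(** * Coprimality and cubes in [Z] *)

Lemma rel_prime_of_comb x y a b : a * x + b * y = 1 -> rel_prime x y.
Proof. intro H; apply bezout_rel_prime, (Bezout_intro _ _ _ a b H). Qed.

Lemma rel_prime_comb x y : rel_prime x y -> exists a b, a * x + b * y = 1.
Proof. intro H; destruct (rel_prime_bezout _ _ H) as [a b E]; eauto. Qed.

Lemma rel_prime_3 x : ~ (3 | x) -> rel_prime x 3.
Proof. intro H; apply rel_prime_sym, prime_rel_prime; [exact prime_3 | exact H]. Qed.

Lemma not_div3 x : ~ (3 | x) -> exists k, x = 3 * k + 1 \/ x = 3 * k - 1.
Proof.
  intro H; pose proof (Z.div_mod x 3); pose proof (Z.mod_pos_bound x 3).
  assert (x mod 3 <> 0) by (intro E; apply H, Z.mod_divide; lia).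
  assert (Hm : x mod 3 = 1 \/ x mod 3 = 2) by lia.
  destruct Hm; [exists (x / 3) | exists (x / 3 + 1)]; lia.
Qed.

(** [A^2 - A B + B^2] is the norm of [A + B omega], which is coprime to its conjugate because [A],
    [B] are coprime and 3 divides [B]. So [A + B omega] is a unit times a cube
    [(a + b omega)^3 = P + Q omega], where [Q = 3 a b (a - b)]; as 3 divides [B], the unit is 1 or
    -1. *)
Lemma form_cube A B V : rel_prime A B -> (3 | B) -> A * A - A * B + B * B = V * V * V ->
  exists a b, rel_prime a b /\ B = 3 * (a * b * (a - b)).
Proof.
  intros Hc H3 HV.
  assert (HA : ~ (3 | A)).
  { intro H; assert (D : (3 | 1)) by (apply Hc; assumption).
    apply Z.divide_1_r in D; lia. }
  assert (Hcop : rel_prime (A * A - A * B + B * B) (3 * B)).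
  { apply rel_prime_mult.
    - apply rel_prime_3; intros [k Hk]; destruct H3 as [l ->].
      destruct (not_div3 A HA) as [m [-> | ->]]; lia.
    - destruct (rel_prime_comb _ _ (rel_prime_mult _ _ _ (rel_prime_sym _ _ Hc)
        (rel_prime_sym _ _ Hc))) as (r & s & E).
      apply (rel_prime_of_comb _ _ s (r + s * A - s * B)); nia. }
  destruct (rel_prime_comb _ _ Hcop) as (r & s & E).
  set (u := Eis A B).
  assert (Hnu : enorm u = V * V * V) by (unfold enorm, u; cbn [re om]; lia).
  (* [1 + 2 omega] is a square root of -3 and [u - conj u = B (1 + 2 omega)], so
     [t (u - conj u) = 3 s B], the second term of [E]. *)
  set (t := Eis (- s) (- (2 * s))).
  destruct (eis_unit_mul_cube_of_norm_cube u (Eis V 0)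
    (eadd (emul (Eis r 0) (econj u)) t) (eopp t))
    as (e & d & He & Hd).
  - intro H; injection H as H H'; subst; lia.
  - rewrite emul_conj, Hnu; apply eis_ext; unfold ecube, emul; cbn [re om]; ring.
  - apply eis_ext; unfold eone, eadd, emul, econj, eopp, t, u; cbn [re om]; [rewrite <- E|]; ring.
  - destruct d as [a b], e as [e1 e2].
    assert (EA := f_equal re Hd); assert (EB := f_equal om Hd).
    unfold u, ecube, emul in EA, EB; cbn [re om] in EA, EB.
    set (P := a * a * a + b * b * b - 3 * (a * b * b)).
    set (Q := 3 * (a * b * (a - b))).
    assert (EA' : A = e1 * P - e2 * Q) by (rewrite EA; unfold P, Q; ring).
    assert (EB' : B = e1 * Q + e2 * P - e2 * Q) by (rewrite EB; unfold P, Q; ring).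
    assert (Hab : rel_prime a b).
    { apply rel_prime_sym; split; try apply Z.divide_1_l.
      intros x Db Da.
      assert (DP : (x | P)).
      { replace P with (a * (a * a) + b * (b * b - 3 * a * b)) by (unfold P; ring).
        auto using Z.divide_add_r, Z.divide_mul_l. }
      assert (DQ : (x | Q)).
      { replace Q with (a * (3 * (b * (a - b)))) by (unfold Q; ring).
        auto using Z.divide_mul_l. }
      apply Hc; [rewrite EA' | rewrite EB'];
        auto using Z.divide_add_r, Z.divide_sub_r, Z.divide_mul_r. }
    destruct (enorm_eq1 _ He) as [[He2 He1] | He2]; cbn [re om] in *.
    (* For the unit -1, exchanging [a] and [b] changes the sign of [Q]. *)
    + subst e2; destruct He1 as [-> | ->]; [exists a, b | exists b, a];
        (split; [auto using rel_prime_sym | rewrite EB'; unfold Q; ring]).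
    (* Modulo 3 the formula for [B] reads [0 = e2 * P] with [e2] equal to 1 or -1, so 3 divides [P]
       and then [A]. *)
    + exfalso; apply HA; destruct H3 as [k Hk].
      exists (e1 * e2 * (k - e1 * (a * b * (a - b))) + (e1 - e2) * (a * b * (a - b))).
      rewrite EA'; assert (HP : P = e2 * (B - e1 * Q + e2 * Q)).
      { rewrite EB'; destruct He2 as [-> | ->]; ring. }
      rewrite HP, Hk; unfold Q; destruct He2 as [-> | ->]; ring.
Qed.

(** With [d] the gcd of [u] and [w], [d^3] and [u] divide each other by the same expansions as in
    the Eisenstein integers; a sign is absorbed into [d]. The divisor relation to [w] is kept to
    measure progress in the descent. *)
Lemma cube_of_coprime u v w : rel_prime u v -> u * v = w * w * w ->
  exists d, (d | w) /\ u = d * d * d.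
Proof.
  intros Hc Huv.
  destruct (Zgcd_is_gcd u w) as [[u' Eu] [w' Ew] _].
  destruct (Z.gcd_bezout u w (Z.gcd u w) eq_refl) as (r & s & Ed).
  set (d := Z.gcd u w) in *.
  destruct (rel_prime_comb _ _ Hc) as (a & b & E).
  assert (H1 : (d * d * d | u)).
  { exists (a * a * u' * u' * u' + (b * b * v + 2 * a * b * u) * w' * w' * w').
    transitivity (u * ((a * u + b * v) * (a * u + b * v))); [rewrite E; ring|].
    transitivity (a * a * (u * u * u) + (b * b * v + 2 * a * b * u) * (u * v)); [ring|].
    rewrite Huv, Ew; rewrite Eu at 1 2 3; ring. }
  assert (H2 : (u | d * d * d)).
  { exists (s * s * s * v + r * r * r * u * u + 3 * r * r * u * s * w + 3 * r * s * s * w * w).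
    transitivity (s * s * s * (u * v) + (d * d * d - s * s * s * (w * w * w))); [rewrite Huv; ring|].
    rewrite <- Ed; ring. }
  destruct (Z.divide_antisym _ _ H2 H1) as [Hu | Hu];
    [exists d | exists (- d)]; (split; [| lia]).
  - exists w'; exact Ew.
  - exists (- w'); lia.
Qed.

Lemma cubes_of_coprime3 u v m w :
  rel_prime u v -> rel_prime u m -> rel_prime v m -> u * v * m = w * w * w ->
  exists a b c, (a | w) /\ (b | w) /\ (c | w) /\
    u = a * a * a /\ v = b * b * b /\ m = c * c * c.
Proof.
  intros Huv Hum Hvm E.
  destruct (cube_of_coprime u (v * m) w) as (a & Da & Ea);
    [apply rel_prime_mult; assumption | lia |].
  destruct (cube_of_coprime v (u * m) w) as (b & Db & Eb);
    [apply rel_prime_mult; auto using rel_prime_sym | lia |].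
  destruct (cube_of_coprime m (u * v) w) as (c & Dc & Ec);
    [apply rel_prime_mult; auto using rel_prime_sym | lia |].
  exists a, b, c; auto 10.
Qed.

(** * Infinite descent for [a b (a - b) = k c^3] *)

Lemma rel_prime_addl x y : rel_prime x y -> rel_prime x (x + y).
Proof.
  intro H; destruct (rel_prime_comb _ _ H) as (a & b & E).
  apply (rel_prime_of_comb _ _ (a - b) b); rewrite <- E; ring.
Qed.

Lemma rel_prime_subr x y : rel_prime x y -> rel_prime x (x - y).
Proof.
  intro H; destruct (rel_prime_comb _ _ H) as (a & b & E).
  apply (rel_prime_of_comb _ _ (a + b) (- b)); rewrite <- E; ring.
Qed.

Lemma rel_prime_factor x y k : rel_prime x (k * y) -> rel_prime x y.
Proof.
  intro H; destruct (rel_prime_comb _ _ H) as (a & b & E).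
  apply (rel_prime_of_comb _ _ a (b * k)); rewrite <- E; ring.
Qed.

(** Put [x + y = 3 s]. Then [x^3 + y^3 = 9 s W] with [W] coprime to [3 s], so [3 k] divides [s] and
    [s / (3 k)] and [W] are coprime with product [z^3]. Both are cubes, and [form_cube] applied to
    [W] writes [s] as [3 a b (a - b)]. *)
Lemma sum_cubes_descent k x y z :
  rel_prime x y -> (k | 3) -> x * x * x + y * y * y = 27 * k * (z * z * z) ->
  exists a b c, rel_prime a b /\ (c | z) /\ a * b * (a - b) = k * (c * c * c).
Proof.
  intros Hc Hk E.
  assert (Hs : (3 | x + y)).
  { assert (D : (3 | (x + y) * (x + y) * (x + y))).
    { exists (9 * k * (z * z * z) + x * x * y + x * y * y); lia. }
    apply prime_mult in D; [| exact prime_3].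
    destruct D as [D | D]; [apply prime_mult in D; [tauto | exact prime_3] | exact D]. }
  destruct Hs as [s Hs].
  (* This is [(x^2 - x y + y^2) / 3] for [y = 3 s - x], and also the norm form at [(x - s, s)]. *)
  pose (W := x * x - 3 * s * x + 3 * s * s).
  assert (Hxs : rel_prime x s).
  { apply (rel_prime_factor _ _ 3); replace (3 * s) with (x + y) by lia.
    apply rel_prime_addl, Hc. }
  assert (Hx3 : rel_prime x 3).
  { apply rel_prime_sym, (rel_prime_div (x + y));
     [apply rel_prime_sym, rel_prime_addl, Hc | exists s; lia]. }
  assert (Hx3s : rel_prime (x * x) (3 * s)).
  { apply rel_prime_sym, rel_prime_mult; apply rel_prime_sym, rel_prime_mult; assumption. }
  assert (HW : rel_prime (3 * s) W).
  { destruct (rel_prime_comb _ _ Hx3s) as (a & b & Eab).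
    apply (rel_prime_of_comb _ _ (b - a * (s - x)) a); unfold W; rewrite <- Eab; ring. }
  assert (HsW : s * W = 3 * k * (z * z * z)).
  { replace y with (3 * s - x) in E by lia; unfold W; lia. }
  assert (D : (3 * k | s)).
  { apply (Gauss _ W); [exists (z * z * z); lia |].
    assert (H3W : rel_prime 3 W) by (apply (rel_prime_div _ _ _ HW); exists s; ring).
    apply rel_prime_sym, rel_prime_mult; apply rel_prime_sym; [assumption|].
    apply (rel_prime_div _ _ _ H3W Hk). }
  destruct D as [t Ht].
  assert (Hk0 : k <> 0) by (intros ->; destruct Hk as [? ?]; lia).
  assert (HtW : t * W = z * z * z) by nia.
  assert (HrtW : rel_prime t W).
  { apply (rel_prime_div _ _ _ HW); exists (9 * k); lia. }
  destruct (cube_of_coprime t W z HrtW HtW) as (c & Dc & Ec).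
  destruct (cube_of_coprime W t z (rel_prime_sym _ _ HrtW)) as (V & _ & EV); [lia|].
  destruct (form_cube (x - s) s V) as (a & b & Hab & Es).
  - destruct (rel_prime_comb _ _ Hxs) as (p & q & Epq).
    apply (rel_prime_of_comb _ _ p (p + q)); rewrite <- Epq; ring.
  - exists (t * k); lia.
  - rewrite <- EV; unfold W; ring.
  - exists a, b, c; split; [exact Hab | split; [exact Dc | subst t; lia]].
Qed.

(** [step] followed by [sum_cubes_descent] yields a solution whose [c'] satisfies [3 c' | c], so
    [|c'| < |c|] unless [c = 0]. *)
Lemma infinite_descent k : (k | 3) ->
  (forall a b c, rel_prime a b -> a * b * (a - b) = k * (c * c * c) ->
    exists x y z, rel_prime x y /\ x * x * x + y * y * y = 27 * k * (z * z * z) /\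
      (3 * z | c)) ->
  forall a b c, rel_prime a b -> a * b * (a - b) = k * (c * c * c) -> c = 0.
Proof.
  intros Hk step a b c; remember (Z.abs_nat c) as n eqn:Hn.
  revert a b c Hn; induction n as [n IH] using (well_founded_induction Wf_nat.lt_wf).
  intros a b c -> Hab E.
  destruct (step _ _ _ Hab E) as (x & y & z & Hxy & Exy & [m Hm]).
  destruct (sum_cubes_descent k x y z Hxy Hk Exy) as (a' & b' & c' & Hab' & [l Hl] & E').
  destruct (Z.eq_dec c 0) as [|Hc]; [assumption|].
  assert (Ec : c = 3 * (m * l) * c') by (rewrite Hm, Hl; ring).
  assert (Hml : m * l <> 0) by (intro H; rewrite H in Ec; lia).
  destruct (Z.eq_dec c' 0) as [H0|H0]; [rewrite Ec, H0; ring|].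
  assert (Hlt : Z.abs c' < Z.abs c) by (rewrite Ec, !Z.abs_mul; nia).
  exfalso; apply H0, (IH (Z.abs_nat c')) with (a := a') (b := b'); auto; lia.
Qed.

Lemma rel_prime_cubes x y : rel_prime (x * x * x) (y * y * y) -> rel_prime x y.
Proof.
  intro H; apply (rel_prime_div (x * x * x)); [| exists (x * x); ring].
  apply rel_prime_sym, (rel_prime_div (y * y * y)); [| exists (y * y); ring].
  apply rel_prime_sym, H.
Qed.

Lemma rel_prime_oppr x y : rel_prime x y -> rel_prime x (- y).
Proof.
  intro H; destruct (rel_prime_comb _ _ H) as (a & b & E).
  apply (rel_prime_of_comb _ _ a (- b)); rewrite <- E; ring.
Qed.

(** Cubes prime to 3 are 1 or -1 modulo 9, and three such signs never sum to 0 modulo 9. *)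
Lemma sum3_cubes_div3 x y z : x * x * x + y * y * y + z * z * z = 0 ->
  (3 | x) \/ (3 | y) \/ (3 | z).
Proof.
  intro E.
  destruct (Zdivide_dec 3 x); [auto|]; destruct (Zdivide_dec 3 y); [auto|].
  destruct (Zdivide_dec 3 z); [auto|]; exfalso.
  destruct (not_div3 x) as [i [-> | ->]]; destruct (not_div3 y) as [j [-> | ->]];
    destruct (not_div3 z) as [k [-> | ->]]; auto; lia.
Qed.

Lemma rel_prime_diff a b : rel_prime a b -> rel_prime a (a - b) /\ rel_prime b (a - b).
Proof.
  intro H; split; [apply rel_prime_subr, H|].
  replace (a - b) with (- (b - a)) by ring.
  apply rel_prime_oppr, rel_prime_subr, rel_prime_sym, H.
Qed.

(** The pairwise coprime factors are cubes with [x^3 = y^3 + z^3]. One of the three bases is a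
    multiple of 3; isolating its cube gives the factor 27 that the descent needs. *)
Lemma prod_diff_cube a b c : rel_prime a b -> a * b * (a - b) = c * c * c -> c = 0.
Proof.
  intros Hab E; apply (infinite_descent 1) with (a := a) (b := b); auto;
    [exists 3; reflexivity | clear a b c Hab E | lia].
  intros a b c Hab E.
  destruct (rel_prime_diff _ _ Hab) as [Ha Hb].
  destruct (cubes_of_coprime3 a b (a - b) c) as (x & y & z & Dx & Dy & Dz & Ex & Ey & Ez);
    auto; [lia|].
  rewrite Ex, Ey in Hab; rewrite Ez, Ex in Ha; rewrite Ez, Ey in Hb.
  apply rel_prime_cubes in Hab, Ha, Hb.
  destruct (sum3_cubes_div3 x (- y) (- z)) as [[t Ht] | [[t Ht] | [t Ht]]]; [lia | ..].
  - assert (Ex3 : x = 3 * t) by lia.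
    exists y, z, t; split; [assumption | split; [| rewrite <- Ex3; assumption]].
    transitivity (x * x * x); [lia | rewrite Ex3; ring].
  - assert (Ey3 : y = 3 * - t) by lia.
    exists x, (- z), (- t); split; [apply rel_prime_oppr; assumption |].
    split; [| rewrite <- Ey3; assumption].
    transitivity (y * y * y); [lia | rewrite Ey3; ring].
  - assert (Ez3 : z = 3 * - t) by lia.
    exists x, (- y), (- t); split; [apply rel_prime_oppr; assumption |].
    split; [| rewrite <- Ez3; assumption].
    transitivity (z * z * z); [lia | rewrite Ez3; ring].
Qed.

(** Modulo 9, a sum of two cubes is never 3 or -3. *)
Lemma sum2_cubes_triple_div3 x y z : x * x * x + y * y * y = 3 * (z * z * z) -> (3 | z).
Proof.
  intro E; destruct (Zdivide_dec 3 z); [assumption | exfalso].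
  assert (H3 : forall w, exists k, w = 3 * k \/ w = 3 * k + 1 \/ w = 3 * k - 1).
  { intro w; destruct (Zdivide_dec 3 w) as [[k Hk] | H]; [exists k; lia|].
    destruct (not_div3 w H) as [k Hk]; exists k; tauto. }
  destruct (H3 x) as [i [-> | [-> | ->]]]; destruct (H3 y) as [j [-> | [-> | ->]]];
    destruct (not_div3 z) as [k [-> | ->]]; auto; lia.
Qed.

(** A factor divisible by 3 is three times a cube and the other two are cubes, so two coprime cubes
    sum to [3 z^3]. Then 3 divides [z], which supplies the missing 27. *)
Lemma prod_diff_triple_cube a b c :
  rel_prime a b -> a * b * (a - b) = 3 * (c * c * c) -> c = 0.
Proof.
  intros Hab E; apply (infinite_descent 3) with (a := a) (b := b); auto;
    [exists 1; reflexivity | clear a b c Hab E].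
  intros a b c Hab E.
  destruct (rel_prime_diff _ _ Hab) as [Ha Hb].
  assert (key : forall x y z, rel_prime x y -> x * x * x + y * y * y = 3 * (z * z * z) ->
    (z | c) -> exists x y z, rel_prime x y /\
      x * x * x + y * y * y = 27 * 3 * (z * z * z) /\ (3 * z | c)).
  { intros x y z Hxy Exy Dz; destruct (sum2_cubes_triple_div3 _ _ _ Exy) as [t ->].
    exists x, y, t; split; [assumption | split; [lia |]].
    replace (3 * t) with (t * 3) by ring; assumption. }
  assert (D : (3 | a * b * (a - b))) by (exists (c * c * c); lia).
  apply prime_mult in D; [| exact prime_3].
  destruct D as [D | [m Em]]; [apply prime_mult in D; [| exact prime_3] |].
  - destruct D as [[m Em] | [m Em]].
    + assert (Dm : (m | a)) by (exists 3; lia).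
      destruct (cubes_of_coprime3 m b (a - b) c) as (x & y & z & Dx & _ & _ & Ex & Ey & Ez).
      1-2: apply (rel_prime_div a); assumption.
      1: assumption.
      1: rewrite Em in E at 1; lia.
      rewrite Ez, Ey in Hb; apply rel_prime_cubes in Hb.
      apply (key y z x); auto; lia.
    + assert (Dm : (m | b)) by (exists 3; lia).
      destruct (cubes_of_coprime3 m a (a - b) c) as (x & y & z & Dx & _ & _ & Ex & Ey & Ez).
      1-2: apply (rel_prime_div b); auto using rel_prime_sym.
      1: assumption.
      1: rewrite Em in E at 1; lia.
      rewrite Ez, Ey in Ha; apply rel_prime_cubes in Ha.
      apply (key y (- z) x); auto using rel_prime_oppr; lia.
  - assert (Dm : (m | a - b)) by (exists 3; lia).
    destruct (cubes_of_coprime3 m a b c) as (x & y & z & Dx & _ & _ & Ex & Ey & Ez).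
    1-2: apply (rel_prime_div (a - b)); auto using rel_prime_sym.
    1: assumption.
    1: rewrite Em in E; lia.
    rewrite Ez, Ey in Hab; apply rel_prime_cubes in Hab.
    apply (key y (- z) x); auto using rel_prime_oppr; lia.
Qed.

(** * Cube factors of [x^3 - 1] *)

Lemma cube_or_cube u v p c :
  prime p -> rel_prime u v -> u * v = p * p * (c * c * c) ->
  (exists d, u = d * d * d) \/ (exists d, v = d * d * d).
Proof.
  intros Hp Huv E.
  (* If [p] does not divide [u], then [p^2] divides [v]; cancelling it leaves coprime factors of a
     cube. *)
  assert (key : forall u v, rel_prime u v -> u * v = p * p * (c * c * c) ->
    ~ (p | u) -> exists d, u = d * d * d).
  { clear u v Huv E; intros u v Huv E Hpu.
    assert (Hpp : rel_prime (p * p) u).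
    { apply prime_rel_prime in Hpu; [| assumption].
      apply rel_prime_sym, rel_prime_mult; apply rel_prime_sym; assumption. }
    destruct (Gauss (p * p) u v) as [w Ew]; [exists (c * c * c); lia | assumption |].
    pose proof (prime_ge_2 _ Hp).
    destruct (cube_of_coprime u w c) as (d & _ & Ed); [| | eauto].
    - apply rel_prime_sym, (rel_prime_div v);
        [apply rel_prime_sym; assumption | exists (p * p); lia].
    - apply (Z.mul_reg_l _ _ (p * p)); [nia | rewrite <- E, Ew; ring]. }
  destruct (Zdivide_dec p u) as [Du | Du]; [right | left; eauto].
  apply (key v u); [apply rel_prime_sym; assumption | lia |].
  intro Dv; pose proof (prime_ge_2 _ Hp).
  destruct Huv as [_ _ H1]; specialize (H1 p Du Dv); apply Z.divide_1_r in H1; lia.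
Qed.

Lemma cube_pred_factors x p a :
  prime p -> ~ (3 | x - 1) -> x * x * x - 1 = p * p * (a * a * a) ->
  (exists u, x - 1 = u * u * u) \/ (exists v, x * x + x + 1 = v * v * v).
Proof.
  intros Hp H3 E; apply (cube_or_cube _ _ p a Hp); [| rewrite <- E; ring].
  destruct (rel_prime_comb _ _ (rel_prime_3 _ H3)) as (r & s & Ers).
  (* The coefficients come from [x^2 + x + 1 = (x - 1) (x + 2) + 3]. *)
  apply (rel_prime_of_comb _ _ (r - s * (x + 2)) s); transitivity (r * (x - 1) + s * 3); [ring | exact Ers].
Qed.

(** For [x = 3 t + 1], [x^3 - 1 = 9 t W]. If [p = 3], the 9 cancels [p^2]; otherwise 3 divides [a],
    and 3 divides [t] because [W] is 1 modulo 3, so [cube_or_cube] applies to [t / 3] and [W]. *)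
Lemma cube_pred_factors_mod3 t p a :
  prime p -> (3 * t + 1) * (3 * t + 1) * (3 * t + 1) - 1 = p * p * (a * a * a) ->
  (exists u, t = 3 * (u * u * u)) \/ (exists v, 3 * t * t + 3 * t + 1 = v * v * v).
Proof.
  intros Hp E; set (W := 3 * t * t + 3 * t + 1).
  assert (E' : 9 * (t * W) = p * p * (a * a * a)) by (rewrite <- E; unfold W; ring).
  assert (HtW : rel_prime t W).
  { apply (rel_prime_of_comb _ _ (- (3 * t + 3)) 1); unfold W; ring. }
  assert (H3W : rel_prime 3 W).
  { apply (rel_prime_of_comb _ _ (- (t * t + t)) 1); unfold W; ring. }
  destruct (Z.eq_dec p 3) as [-> | Hp3].
  - destruct (cube_of_coprime W t a) as (v & _ & Ev);
      [apply rel_prime_sym; assumption | lia | eauto].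
  - assert (Da : (3 | a)).
    { assert (D : (3 | p * (p * (a * (a * a))))) by (exists (3 * (t * W)); lia).
      assert (D3p : ~ (3 | p)).
      { intro D3; apply Hp3; symmetry; apply prime_div_prime; [exact prime_3 | assumption..]. }
      repeat (apply prime_mult in D; [| exact prime_3]; destruct D as [D | D]);
        tauto. }
    destruct Da as [a' ->].
    assert (E3 : t * W = 3 * (p * p * (a' * a' * a'))) by lia.
    destruct (Gauss 3 W t) as [s Hs];
      [exists (p * p * (a' * a' * a')); lia | assumption |].
    destruct (cube_or_cube s W p a') as [[u Hu] | H]; [assumption | | | | auto].
    + apply (rel_prime_div t); [assumption | exists 3; lia].
    + apply (Z.mul_reg_l _ _ 3); [lia | rewrite <- E3, Hs; ring].
    + left; exists u; lia.
Qed.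

(** * Combinations of cubes excluded by size *)

Lemma cube_lt_inv x y : x * x * x < y * y * y -> x < y.
Proof.
  intro H; destruct (Z_lt_le_dec x y); [assumption |].
  assert (0 <= (x - y) * (x * x + x * y + y * y)) by (apply Z.mul_nonneg_nonneg; nia).
  lia.
Qed.

Lemma cubes_differ_by_2 x u s : x - 1 = u * u * u -> - x - 1 = s * s * s -> x = 0.
Proof.
  intros Hu Hs; set (d := - s - u).
  assert (Hd : d * (3 * u * u + 3 * u * d + d * d) = 2).
  { transitivity ((- s) * (- s) * (- s) - u * u * u); [unfold d; ring | lia]. }
  (* Four times the quadratic factor is [3 (2 u + d)^2 + d^2]; this makes [d] positive and bounds
     [d^3] by 8. *)
  assert (HN : d * d <= 4 * (3 * u * u + 3 * u * d + d * d)).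
  { pose proof (Z.square_nonneg (2 * u + d)); lia. }
  clearbody d; assert (Hd12 : d = 1 \/ d = 2).
  { set (N := 3 * u * u + 3 * u * d + d * d) in *; clearbody N; nia. }
  destruct Hd12 as [Ed | Ed]; rewrite Ed in Hd; [lia |].
  assert (Hu1 : (u + 1) * (u + 1) = 0) by lia.
  apply Z.mul_eq_0 in Hu1; assert (Eu : u = -1) by lia; rewrite Eu in Hu; lia.
Qed.

(** The cubes differ by [2 x], and [v >= w + 1], so [x] exceeds [w^2]. Then [x^2 - x + 1] is already
    larger than [w^3]. *)
Lemma conjugate_forms_not_both_cubes x v w :
  0 < x -> x * x + x + 1 = v * v * v -> x * x - x + 1 = w * w * w -> False.
Proof.
  intros Hx Hv Hw.
  assert (Hw0 : 0 < w) by (apply cube_lt_inv; nia).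
  assert (Hvw : w < v) by (apply cube_lt_inv; lia).
  assert (H1 : (w + 1) * (w + 1) * (w + 1) <= v * v * v).
  { apply Z.mul_le_mono_nonneg; [nia | | lia | lia].
    apply Z.mul_le_mono_nonneg; lia. }
  assert (H2 : 2 * x >= 3 * w * w + 3 * w + 1) by lia.
  assert (H3 : x - 1 >= w * w) by nia.
  assert (H4 : x >= 2 * w) by nia.
  assert (H5 : x * (x - 1) >= 2 * w * (w * w)) by nia.
  nia.
Qed.

(* [u^6 + u^3 + 1] lies strictly between consecutive cubes unless [u] is [0] or [-1]. *)
Lemma sextic_not_cube x u v : - x - 1 = u * u * u -> x * x + x + 1 = v * v * v ->
  x = 0 \/ x = -1.
Proof.
  intros Hu Hv; set (U := u * u * u) in *; set (q := u * u).
  assert (Hx : x = - U - 1) by lia.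
  assert (Eq : q * q * q = U * U) by (unfold q, U; ring).
  assert (EV : U * U + U + 1 = v * v * v) by (rewrite <- Hv, Hx; ring).
  destruct (Z.eq_dec u 0) as [-> | Hu0]; [right; unfold U in Hx; lia|].
  destruct (Z.eq_dec u (-1)) as [-> | Hu1]; [left; unfold U in Hx; lia|].
  exfalso; destruct (Z_lt_le_dec 0 u) as [Hp | Hn].
  - assert (HU : 0 < U) by (unfold U; nia).
    assert (q < v) by (apply cube_lt_inv; lia).
    assert (HUq : U <= q * q) by (unfold U, q; nia).
    assert (Hq : 0 < q) by (unfold q; nia).
    assert (v < q + 1) by (apply cube_lt_inv; lia).
    lia.
  - assert (HU : U < -1) by (unfold U; nia).
    assert (v < q) by (apply cube_lt_inv; lia).
    assert (HUq : - U <= q * q) by (unfold U, q; nia).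
    assert (Hq : 4 <= q) by (unfold q; nia).
    assert (q - 1 < v) by (apply cube_lt_inv; nia).
    lia.
Qed.

(** * The case of [x] congruent to 1 modulo 3 *)

Lemma neg_two_mod9_not_cube u s : - (9 * (u * u * u) + 1) - 1 <> s * s * s.
Proof.
  intro E; destruct (Zdivide_dec 3 s) as [[k ->] | H]; [lia|].
  destruct (not_div3 s H) as [k [-> | ->]]; lia.
Qed.

(** [n^2 + n + 1] is the norm form at [(n + 1, n)], so [form_cube] gives [a b (a - b) = 3 u^3],
    Legendre's equation. *)
Lemma form_nine_cube u w :
  let n := 9 * (u * u * u) in n * n + n + 1 = w * w * w -> u = 0.
Proof.
  intros n E.
  destruct (form_cube (n + 1) n w) as (a & b & Hab & En).
  - apply (rel_prime_of_comb _ _ 1 (-1)); ring.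
  - exists (3 * (u * u * u)); unfold n; ring.
  - rewrite <- E; ring.
  - apply (prod_diff_triple_cube a b); [assumption | unfold n in En; lia].
Qed.

(** The left side is [(t + 1)^3 - t^3], so this is Fermat's equation with exponent 3. *)
Lemma central_form_cube t v : 3 * t * t + 3 * t + 1 = v * v * v -> t = 0 \/ t = -1.
Proof.
  intro E.
  assert (H : (t + 1) * t * v = 0).
  { apply (prod_diff_cube ((t + 1) * (t + 1) * (t + 1)) (t * t * t)).
    - assert (H : rel_prime (t + 1) t) by (apply (rel_prime_of_comb _ _ 1 (-1)); ring).
      repeat (apply rel_prime_mult || apply rel_prime_sym, rel_prime_mult);
        auto using rel_prime_sym.
    - replace ((t + 1) * (t + 1) * (t + 1) - t * t * t) with (v * v * v) by lia; ring. }
  apply Z.mul_eq_0 in H; destruct H as [H | ->]; [| lia].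
  apply Z.mul_eq_0 in H; lia.
Qed.

(** Disposes of the few small [x] that survive: one of [x^3 - 1] and [x^3 + 1] is then 1, 2 or 7 up
    to sign, neither a multiple of 4 nor of absolute value at least 9. *)
Lemma prime_sq_cube_small p a : prime p ->
  (4 | p * p * (a * a * a)) \/ 9 <= Z.abs (p * p * (a * a * a)).
Proof.
  intro Hp; pose proof (prime_ge_2 _ Hp).
  destruct (Z.eq_dec p 2) as [-> | H2]; [left; exists (a * a * a); ring|].
  destruct (Z.eq_dec a 0) as [-> | Ha]; [left; exists 0; ring | right].
  rewrite !Z.abs_mul.
  assert (1 <= Z.abs a * Z.abs a * Z.abs a) by nia.
  assert (9 <= Z.abs p * Z.abs p) by nia.
  nia.
Qed.

(** Writing the second equation through [(-x)^3 - 1] lets the factor lemmas serve both equations and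
    allows exchanging [x] and [- x]. When [x - 1 = 9 u^3], a cube [- x - 1] is impossible modulo 9,
    and a cube [x^2 - x + 1] forces [u = 0]. *)
Lemma no_cube_neighbours_mod3 t p q a b : prime p -> prime q ->
  let x := 3 * t + 1 in
  x * x * x - 1 = p * p * (a * a * a) -> - x * - x * - x - 1 = q * q * (b * b * b) -> False.
Proof.
  intros Hp Hq x Ea Eb.
  assert (H3 : ~ (3 | - x - 1)) by (intros [k Hk]; unfold x in Hk; lia).
  assert (Ht : t = 0 \/ t = -1).
  { destruct (cube_pred_factors_mod3 t p a Hp Ea) as [[u Hu] | [v Hv]].
    - left; destruct (cube_pred_factors (- x) q b Hq H3 Eb) as [[s Hs] | [w Hw]].
      + exfalso; apply (neg_two_mod9_not_cube u s); rewrite <- Hs; unfold x; lia.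
      + rewrite Hu, (form_nine_cube u w); [reflexivity|].
        rewrite <- Hw; unfold x; rewrite Hu; ring.
    - apply (central_form_cube t v Hv). }
  destruct (prime_sq_cube_small q b Hq) as [D | D]; rewrite <- Eb in D;
    unfold x in D; destruct Ht as [-> | ->]; try (destruct D as [k Hk]); lia.
Qed.

(** * Combination of the cases over [Z] *)

Lemma no_cube_neighbours x p q a b : prime p -> prime q ->
  x * x * x - 1 = p * p * (a * a * a) -> x * x * x + 1 = q * q * (b * b * b) -> False.
Proof.
  intros Hp Hq Ea Eb.
  assert (Eb' : - x * - x * - x - 1 = q * q * (- b * - b * - b)) by lia.
  destruct (Zdivide_dec 3 (x - 1)) as [[t Ht] | H1].
  { assert (Ex : x = 3 * t + 1) by lia; subst x.
    eapply (no_cube_neighbours_mod3 t p q); eassumption. }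
  destruct (Zdivide_dec 3 (- x - 1)) as [[t Ht] | H2].
  { assert (Ex : - x = 3 * t + 1) by lia; rewrite Ex in Eb'.
    apply (no_cube_neighbours_mod3 t q p (- b) a Hq Hp Eb').
    rewrite <- Ex; lia. }
  (* Each equation now makes its linear or its quadratic factor a cube, which leaves four
     combinations. *)
  assert (Hx : x = 0 \/ x = -1 \/ x = 1).
  { destruct (cube_pred_factors x p a Hp H1 Ea) as [[u Hu] | [v Hv]];
      destruct (cube_pred_factors (- x) q (- b) Hq H2 Eb') as [[s Hs] | [w Hw]].
    - left; apply (cubes_differ_by_2 x u s); assumption.
    - destruct (sextic_not_cube (- x) u w); lia.
    - destruct (sextic_not_cube x s v); lia.
    - destruct (Z.lt_trichotomy x 0) as [Hx | [Hx | Hx]]; [exfalso | lia | exfalso].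
      + apply (conjugate_forms_not_both_cubes (- x) w v); lia.
      + apply (conjugate_forms_not_both_cubes x v w); lia. }
  destruct (prime_sq_cube_small p a Hp) as [D | D]; rewrite <- Ea in D;
    destruct (prime_sq_cube_small q b Hq) as [D' | D']; rewrite <- Eb in D';
    try (destruct D as [k Hk]); try (destruct D' as [l Hl]);
    destruct Hx as [-> | [-> | ->]]; lia.
Qed.

End ConsecutivePowerful.

(* Transfer to MathComp integers and primes *)
Require Import Defs.
From mathcomp Require Import all_boot all_order all_algebra.
From mathcomp Require Import zify ssrZ.
Import GRing.Theory Num.Theory.
Local Open Scope ring_scope.

Lemma prime_Z_of_nat (p : nat) : prime p -> Znumtheory.prime (Z.of_nat p).
Proof.
move=> pr_p; apply/prime_alt; split; first by have := prime_gt1 pr_p; lia.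
move=> n n_bnd [m def_p]; have /primeP[_ /(_ (Z.to_nat n))] := pr_p.
have -> : (Z.to_nat n %| p)%N by apply/dvdnP; exists (Z.to_nat m); nia.
by move=> /(_ isT) /orP[] /eqP; lia.
Qed.

(* Primes p, q are natural numbers cast into int; a, b, x range over int. *)
Theorem theorem1 :
  ~ (exists (a b x : int) (p q : nat),
       [/\ prime p, prime q,
           x ^+ 3 - 1 = (p%:Z) ^+ 2 * a ^+ 3
         & x ^+ 3 + 1 = (q%:Z) ^+ 2 * b ^+ 3]).
Proof.
move=> [a [b [x [p [q [/prime_Z_of_nat pr_p /prime_Z_of_nat pr_q]]]]]].
rewrite !exprS !expr0 !mulr1 => Ea Eb.
by apply: (@no_cube_neighbours (Z_of_int x) _ _ (Z_of_int a) (Z_of_int b) pr_p pr_q); lia.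
Qed.
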